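(* Let $n\ge 1$ and consider, on $\{(x,t): x\in\mathbb{R}^n\setminus\{0\},\ t>0\}$, the system $$u_t+(u\cdot\nabla)u=0,\qquad \rho_t+\nabla\cdot(\rho u)=0 .$$ Let $q,\rho$ be smooth functions of $(r,t)$, $r>0$, $t>0$, and put $u(x,t)=\frac{x}{r}q(r,t)$, $\rho(x,t)=\rho(r,t)$, $r=|x|$. Then $(u,\rho)$ solves this system if and only if $(q,\rho)$ satisfies $$q_t+qq_r=0,\qquad \rho_t+r^{-(n-1)}\big(r^{n-1}\rho q\big)_r=0,\qquad r>0,\ t>0 .$$ Moreover, writing $\rho(r,t)=r^{-(n-1)}p(r,t)$, the second of these equations is equivalent to $p_t+(pq)_r=0$.
   Context: Here $(u\cdot\nabla)u$ is the vector with $j$-th component $\sum_{k=1}^n u_k\,\partial_{x_k}u_j$; subscripts $t,r$ denote partial derivatives. *)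

(* Defs.v *)
From HB Require Import structures.
From mathcomp Require Import all_boot all_order all_algebra.
From mathcomp Require Import all_classical all_reals all_analysis.

Set Implicit Arguments.
Unset Strict Implicit.
Unset Printing Implicit Defensive.

Import Order.TTheory GRing.Theory Num.Theory.
Import numFieldNormedType.Exports.

Local Open Scope classical_set_scope.
Local Open Scope ring_scope.

(* The library norm `|x| on 'rV[R]_n is the sup norm. *)
Definition eucl_norm (R : realType) (n : nat) (x : 'rV[R]_n) : R :=
  Num.sqrt (\sum_(i < n) x 0 i ^+ 2).

Section TwoVariables.
Variable R : realType.
Implicit Types f : R -> R -> R.

Definition partial_r f (r t : R) : R := derive1 (f ^~ t) r.

Definition partial_t f (r t : R) : R := derive1 (f r) t.

(* Class C^k on the open quadrant r > 0, t > 0: the iterated partial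
   derivatives up to order k exist and are jointly continuous there.
   The values of f outside the quadrant are irrelevant. *)
Fixpoint quadrant_Ck (k : nat) f : Prop :=
  (forall r t : R, 0 < r -> 0 < t ->
     {for (r, t), continuous (fun z : R * R => f z.1 z.2)}) /\
  if k is k'.+1 then
    [/\ forall r t : R, 0 < r -> 0 < t ->
          derivable (f ^~ t) r 1 /\ derivable (f r) t 1,
        quadrant_Ck k' (partial_r f) & quadrant_Ck k' (partial_t f)]
  else True.

Definition quadrant_smooth f : Prop := forall k : nat, quadrant_Ck k f.

End TwoVariables.

Section System.
Variables (R : realType) (n : nat).
Implicit Types (u : 'rV[R]_n -> R -> 'rV[R]_n) (rho : 'rV[R]_n -> R -> R).

Definition partial_x (k : 'I_n) (g : 'rV[R]_n -> R) (x : 'rV[R]_n) : R :=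
  'D_(delta_mx 0 k) g x.

Definition divergence (v : 'rV[R]_n -> 'rV[R]_n) (x : 'rV[R]_n) : R :=
  \sum_(k < n) partial_x k (fun y => v y 0 k) x.

Definition advection (v : 'rV[R]_n -> 'rV[R]_n) (x : 'rV[R]_n) : 'rV[R]_n :=
  \row_(j < n) \sum_(k < n) v x 0 k * partial_x k (fun y => v y 0 j) x.

Definition has_first_partials u rho (x : 'rV[R]_n) (t : R) : Prop :=
  [/\ derivable (u x) t 1,
      forall j k, derivable (fun y => u y t 0 j) x (delta_mx 0 k),
      derivable (rho x) t 1 &
      forall k, derivable (rho ^~ t) x (delta_mx 0 k)].

(* The derivative operators are total, with an unspecified value where the
   limit does not exist, so a (classical) solution must also assert that the
   first-order partial derivatives exist. *)
Definition solves_system u rho : Prop :=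
  forall (x : 'rV[R]_n) (t : R), x != 0 -> 0 < t ->
  [/\ has_first_partials u rho x t,
      derive1 (u x) t + advection (u ^~ t) x = 0 &
      derive1 (rho x) t + divergence (fun y => rho y t *: u y t) x = 0].

Definition radial_velocity (q : R -> R -> R) (x : 'rV[R]_n) (t : R) : 'rV[R]_n :=
  q (eucl_norm x) t *: ((eucl_norm x)^-1 *: x).

Definition radial_density (rho : R -> R -> R) (x : 'rV[R]_n) (t : R) : R :=
  rho (eucl_norm x) t.

End System.

Section RadialEquations.
Variable R : realType.
Implicit Types q rho p : R -> R -> R.

Definition radial_momentum_eq q : Prop :=
  forall r t : R, 0 < r -> 0 < t ->
  partial_t q r t + q r t * partial_r q r t = 0.

Definition radial_mass_eq (n : nat) q rho : Prop :=
  forall r t : R, 0 < r -> 0 < t ->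
  partial_t rho r t +
    r ^- n.-1 * partial_r (fun s t' => s ^+ n.-1 * rho s t' * q s t') r t = 0.

Definition weighted_mass_eq q p : Prop :=
  forall r t : R, 0 < r -> 0 < t ->
  partial_t p r t + partial_r (fun s t' => p s t' * q s t') r t = 0.

End RadialEquations.

(* Main.v *)
(** For [f] a function of [r = |x|], the chain rule gives
    [d_k (f(r) x_j) = f'(r) x_k x_j / r + f(r) delta_jk].  With [f = q / r] the
    momentum residual at [x] is [(q_t + q q_r) x / r], and with [f = rho q / r]
    the divergence is [r f' + n f = r^-(n-1) (r^(n-1) rho q)_r].  So the
    residuals of the system are nonzero multiples of the residuals of the radial
    equations, and every [r > 0] is the norm of some [x]. *)
Require Import Defs.
From HB Require Import structures.
From mathcomp Require Import all_boot all_order all_algebra.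
From mathcomp Require Import all_classical all_reals all_analysis.
From mathcomp Require Import ring.
Import Order.TTheory GRing.Theory Num.Theory.
Import numFieldNormedType.Exports.
Local Open Scope ring_scope.

(** * Directional derivatives of compositions and of matrix-valued maps *)

(** Both difference quotients are the same function of [h]; this lets one-variable rules be applied
    along a line. *)
Lemma is_derive_line (R : realType) (V W : normedModType R) (f : V -> W)
    (x v : V) (df : W) :
  is_derive (0 : R) 1 (fun h : R => f (h *: v + x)) df <-> is_derive x v f df.
Proof.
have E : (fun h : R => h^-1 *: (((fun k : R => f (k *: v + x)) \o shift 0) (h *: 1)
    - f (0 *: v + x))) = (fun h : R => h^-1 *: ((f \o shift x) (h *: v) - f x)).
  by apply/funext => h /=; rewrite scale0r add0r addr0 /GRing.scale /= mulr1.
by split=> -[H1 H2]; split; move: H1 H2; rewrite /derivable /derive E.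
Qed.

(** Restricting [g] to the line through [x] reduces this to the one-variable chain rule, so only a
    directional derivative of [g] enters. *)
Lemma is_derive_scalar_comp (R : realType) (V : normedModType R)
    (f : R -> R) (g : V -> R) (x v : V) (a b : R) :
  is_derive (g x) 1 f a -> is_derive x v g b ->
  is_derive x v (fun y => f (g y)) (a * b).
Proof.
move=> Hf /is_derive_line Hg; apply/is_derive_line.
by apply: is_derive1_comp; rewrite scale0r add0r.
Qed.

Lemma is_derive_coord (R : realType) (n : nat) (x v : 'rV[R]_n) (i : 'I_n) :
  is_derive x v (fun y : 'rV[R]_n => y 0 i) (v 0 i).
Proof.
have Hid : derivable (id : 'rV[R]_n -> 'rV[R]_n) x v by exact: derivable_id.
split; first by move/derivable_mxP: Hid; apply.
have := derive_mx Hid; rewrite derive_id => /matrixP/(_ 0 i).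
by rewrite mxE => ->.
Qed.

Lemma is_derive_mx (R : realType) (V : normedModType R) (m n : nat)
    (M : V -> 'M[R]_(m, n)) (x v : V) (dM : 'M[R]_(m, n)) :
  (forall i j, is_derive x v (fun y => M y i j) (dM i j)) -> is_derive x v M dM.
Proof.
move=> H; have HM : derivable M x v.
  by apply/derivable_mxP => i j; case: (H i j).
split=> //; rewrite (derive_mx HM); apply/matrixP => i j.
by rewrite mxE; case: (H i j).
Qed.

(** * The Euclidean norm and functions of it *)

Section EuclideanNorm.
Variables (R : realType) (n : nat).
Implicit Type x : 'rV[R]_n.

Lemma sum_sqr_gt0 x : x != 0 -> 0 < \sum_(i < n) x 0 i ^+ 2.
Proof.
move=> x0; rewrite lt_def sumr_ge0 ?andbT; last by move=> i _; exact: sqr_ge0.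
apply: contra x0 => /eqP/psumr_eq0P => H.
apply/eqP/rowP => i; rewrite mxE; apply/eqP; rewrite -sqrf_eq0.
by apply/eqP; apply: H => // j _; exact: sqr_ge0.
Qed.

Lemma eucl_norm_gt0 x : x != 0 -> 0 < eucl_norm x.
Proof. by move=> /sum_sqr_gt0; rewrite /eucl_norm sqrtr_gt0. Qed.

Lemma sqr_eucl_norm x : eucl_norm x ^+ 2 = \sum_(i < n) x 0 i ^+ 2.
Proof. by rewrite sqr_sqrtr// sumr_ge0// => i _; exact: sqr_ge0. Qed.

Lemma eucl_norm_scale_delta (r : R) (i : 'I_n) :
  0 < r -> eucl_norm (r *: delta_mx 0 i : 'rV[R]_n) = r.
Proof.
move=> r0; rewrite /eucl_norm (bigD1 i)//= big1 => [|j ji].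
  by rewrite !mxE !eqxx/= mulr1 addr0 sqrtr_sqr gtr0_norm.
by rewrite !mxE (negbTE ji) andbF mulr0 expr0n.
Qed.

(** Chain rule for the square root of the sum of squares, which is positive because [x != 0]. *)
Lemma is_derive_eucl_norm x (k : 'I_n) : x != 0 ->
  is_derive x (delta_mx 0 k) (@eucl_norm R n) (x 0 k / eucl_norm x).
Proof.
move=> x0; have S0 := sum_sqr_gt0 x x0; have r0 := eucl_norm_gt0 x x0.
have Hs i : is_derive x (delta_mx 0 k) (fun y : 'rV[R]_n => y 0 i ^+ 2)
    (2%:R * x 0 i * (i == k)%:R).
  have H := is_derive_coord R n x (delta_mx 0 k) i.
  have := @is_deriveX _ _ _ 2 _ _ _ H.
  rewrite exprfctE => /is_derive_eq; apply; rewrite !mxE eqxx/= /GRing.scale/= expr1.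
  by rewrite -mulr_natl.
have HS : is_derive x (delta_mx 0 k) (fun y : 'rV[R]_n => \sum_(i < n) y 0 i ^+ 2)
    (2%:R * x 0 k).
  have := @is_derive_sum _ _ _ _ _ _ _ _ Hs.
  rewrite (_ : \sum_(i < n) _ = fun y : 'rV[R]_n => \sum_(i < n) y 0 i ^+ 2); last first.
    by apply/funext => y; rewrite fct_sumE.
  move=> /is_derive_eq; apply; rewrite (bigD1 k)//= eqxx mulr1 big1 ?addr0// => i.
  by move=> /negbTE ->; rewrite mulr0.
have := @is_derive_scalar_comp _ _ _ _ _ _ _ _ (is_derive1_sqrt S0) HS.
move=> /is_derive_eq; apply; rewrite -/(eucl_norm x); field.
exact: lt0r_neq0.
Qed.

Lemma is_derive_radial (f : R -> R) (df : R) x (k : 'I_n) : x != 0 ->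
  is_derive (eucl_norm x) 1 f df ->
  is_derive x (delta_mx 0 k) (fun y : 'rV[R]_n => f (eucl_norm y))
    (df * (x 0 k / eucl_norm x)).
Proof.
by move=> x0 Hf; apply: is_derive_scalar_comp => //; exact: is_derive_eucl_norm.
Qed.

(** Velocity and flux components both have this shape, so one product rule serves both. *)
Lemma is_derive_radial_coord (f : R -> R) (df : R) x (j k : 'I_n) : x != 0 ->
  is_derive (eucl_norm x) 1 f df ->
  is_derive x (delta_mx 0 k) (fun y : 'rV[R]_n => f (eucl_norm y) * y 0 j)
    (df * (x 0 k / eucl_norm x) * x 0 j + f (eucl_norm x) * (j == k)%:R).
Proof.
move=> x0 Hf; have H1 := is_derive_radial f df x k x0 Hf.
have H2 := is_derive_coord R n x (delta_mx 0 k) j.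
have := @is_deriveM _ _ _ _ _ _ _ _ H1 H2.
rewrite mulrfctE => /is_derive_eq; apply; rewrite !mxE eqxx/= /GRing.scale/=; ring.
Qed.

End EuclideanNorm.

(** * Residuals of the system on radial fields *)

Section Residuals.
Variables (R : realType) (n : nat) (q rho : R -> R -> R).
Hypotheses (q_smooth : quadrant_smooth q) (rho_smooth : quadrant_smooth rho).

Lemma quadrant_smooth_is_derive_r (f : R -> R -> R) (r t : R) :
  quadrant_smooth f -> 0 < r -> 0 < t ->
  is_derive r 1 (f ^~ t) (partial_r f r t).
Proof.
move=> /(_ 1%N)[_ [H _ _]] r0 t0; have [H1 _] := H r t r0 t0.
by rewrite /partial_r derive1E; apply: derivableP.
Qed.

Lemma quadrant_smooth_is_derive_t (f : R -> R -> R) (r t : R) :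
  quadrant_smooth f -> 0 < r -> 0 < t ->
  is_derive t 1 (f r) (partial_t f r t).
Proof.
move=> /(_ 1%N)[_ [H _ _]] r0 t0; have [_ H1] := H r t r0 t0.
by rewrite /partial_t derive1E; apply: derivableP.
Qed.

Lemma is_derive_div_id (f : R -> R) (r df : R) : r != 0 -> is_derive r 1 f df ->
  is_derive r 1 (fun s => f s / s) (df / r - f r / r ^+ 2).
Proof.
move=> r0 Hf; have Hi : is_derive r 1 (fun s : R => s^-1) (- r ^- 2 *: 1).
  exact: (@is_deriveV _ id).
have := @is_deriveM _ _ _ _ _ _ _ _ Hf Hi.
rewrite mulrfctE => /is_derive_eq; apply; rewrite /GRing.scale/=; field.
exact: r0.
Qed.

Lemma radial_flux_derivative (r t : R) : 0 < r -> 0 < t ->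
  is_derive r 1 (fun s => rho s t * q s t)
    (partial_r rho r t * q r t + rho r t * partial_r q r t).
Proof.
move=> r0 t0; have H1 := quadrant_smooth_is_derive_r q r t q_smooth r0 t0.
have H2 := quadrant_smooth_is_derive_r rho r t rho_smooth r0 t0.
have := @is_deriveM _ _ _ _ _ _ _ _ H2 H1.
rewrite mulrfctE => /is_derive_eq; apply; rewrite /GRing.scale/=; ring.
Qed.

Lemma radial_velocity_coord (x : 'rV[R]_n) (t : R) (j : 'I_n) :
  radial_velocity q x t 0 j = q (eucl_norm x) t / eucl_norm x * x 0 j.
Proof. by rewrite !mxE mulrA. Qed.

Variables (x : 'rV[R]_n) (t : R).
Hypotheses (x0 : x != 0) (t0 : 0 < t).
Let r := eucl_norm x.
Let r0 : 0 < r. Proof. exact: eucl_norm_gt0. Qed.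

Lemma is_derive_radial_velocity_x (j k : 'I_n) :
  is_derive x (delta_mx 0 k) (fun y => radial_velocity q y t 0 j)
    ((partial_r q r t / r - q r t / r ^+ 2) * (x 0 k / r) * x 0 j
      + q r t / r * (j == k)%:R).
Proof.
under eq_fun do rewrite radial_velocity_coord.
apply: (@is_derive_radial_coord R n (fun s => q s t / s)) => //.
apply: is_derive_div_id; first exact: lt0r_neq0.
exact: quadrant_smooth_is_derive_r.
Qed.

Lemma is_derive_radial_flux (k : 'I_n) :
  is_derive x (delta_mx 0 k)
    (fun y => (radial_density rho y t *: radial_velocity q y t) 0 k)
    (((partial_r rho r t * q r t + rho r t * partial_r q r t) / r
      - rho r t * q r t / r ^+ 2) * (x 0 k / r) * x 0 k + rho r t * q r t / r).
Proof.
under eq_fun do rewrite mxE radial_velocity_coord /radial_density 2!mulrA.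
have := @is_derive_radial_coord R n (fun s => rho s t * q s t / s) _ x k k x0
  (is_derive_div_id _ _ _ (lt0r_neq0 r0) (radial_flux_derivative r t r0 t0)).
by rewrite eqxx mulr1.
Qed.

Lemma is_derive_radial_velocity_t :
  is_derive t 1 (radial_velocity q x) (partial_t q r t *: (r^-1 *: x)).
Proof.
apply: is_derive_mx => i j; rewrite ord1 mxE.
under eq_fun do rewrite mxE.
have H := quadrant_smooth_is_derive_t q r t q_smooth r0 t0.
have := @is_deriveM _ _ _ _ _ _ _ _ H (is_derive_cst ((r^-1 *: x) 0 j) t 1).
by rewrite mulrfctE => /is_derive_eq; apply; rewrite scaler0 add0r /GRing.scale/= mulrC.
Qed.

(** Discharges the existence clause in [solves_system] when passing from the radial equations to the
    system. *)
Lemma radial_has_first_partials :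
  has_first_partials (radial_velocity q) (radial_density rho) x t.
Proof.
split.
- by case: is_derive_radial_velocity_t.
- by move=> j k; case: (is_derive_radial_velocity_x j k).
- by case: (quadrant_smooth_is_derive_t rho r t rho_smooth r0 t0).
- move=> k; have H := quadrant_smooth_is_derive_r rho r t rho_smooth r0 t0.
  by case: (@is_derive_radial R n _ _ x k x0 H).
Qed.

Lemma radial_momentum_residual :
  derive1 (radial_velocity q x) t + advection (radial_velocity q ^~ t) x =
  (partial_t q r t + q r t * partial_r q r t) *: (r^-1 *: x).
Proof.
rewrite derive1E; have [_ ->] := is_derive_radial_velocity_t.
rewrite scalerDl; congr (_ + _); apply/rowP => j; rewrite !mxE.
(* [A] is the coefficient of [x_k^2] in [u_k d_k u_j]. Summed over [k], the squares give [A r^2] and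
   the Kronecker term gives [(q/r)^2 x_j]; the [q^2] contributions cancel, leaving
   [q q_r x_j / r]. *)
pose A := (partial_r q r t / r - q r t / r ^+ 2) * q r t / r ^+ 2 * x 0 j.
transitivity (\sum_(k < n) (A * x 0 k ^+ 2 +
    (q r t / r) ^+ 2 * (x 0 k * (j == k)%:R))).
  apply: eq_bigr => k _; rewrite radial_velocity_coord -/r /partial_x.
  have [_ ->] := is_derive_radial_velocity_x j k.
  by rewrite /A; field; exact: lt0r_neq0.
rewrite big_split/= -!mulr_sumr -sqr_eucl_norm -/r.
rewrite (bigD1 j)//= eqxx mulr1 big1 ?addr0; last first.
  by move=> i /negbTE ij; rewrite eq_sym ij mulr0.
by rewrite /A; field; exact: lt0r_neq0.
Qed.

Lemma radial_mass_residual : (1 <= n)%N ->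
  derive1 (radial_density rho x) t
    + divergence (fun y => radial_density rho y t *: radial_velocity q y t) x =
  partial_t rho r t +
    r ^- n.-1 * partial_r (fun s t' => s ^+ n.-1 * rho s t' * q s t') r t.
Proof.
(* The time derivatives agree by conversion; the divergence remains. *)
move=> n1; congr (_ + _).
set d := partial_r rho r t * q r t + rho r t * partial_r q r t.
pose A := (d / r - rho r t * q r t / r ^+ 2) / r.
transitivity (\sum_(k < n) (A * x 0 k ^+ 2 + rho r t * q r t / r)).
  apply: eq_bigr => k _; rewrite /partial_x.
  by have [_ ->] := is_derive_radial_flux k; rewrite /A /d; field; exact: lt0r_neq0.
rewrite big_split/= -mulr_sumr -sqr_eucl_norm -/r sumr_const card_ord.
(* Writing the derivative with [r ^+ n.-1 / r] avoids a second truncated predecessor; for exponent 0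
   both sides vanish. *)
have HX : is_derive r 1 (fun s : R => s ^+ n.-1) (n.-1%:R * r ^+ n.-1 / r).
  have := @is_deriveX _ _ _ n.-1 _ _ _ (is_derive_id r 1).
  rewrite exprfctE => /is_derive_eq; apply; rewrite /GRing.scale/= mulr1.
  case: (n.-1) => [|m]; first by rewrite !mul0r.
  by rewrite /= exprS -mulr_natl; field; exact: lt0r_neq0.
have HD : is_derive r 1 (fun s => s ^+ n.-1 * rho s t * q s t)
    (r ^+ n.-1 *: d + (rho r t * q r t) *: (n.-1%:R * r ^+ n.-1 / r)).
  under eq_fun do rewrite -mulrA.
  exact: (@is_deriveM _ _ _ _ _ _ _ _ HX (radial_flux_derivative r t r0 t0)).
have [_ DE] := HD; rewrite [in RHS]/partial_r derive1E DE /GRing.scale/=.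
(* Here [1 <= n] splits [n] as [n.-1 + 1]: the extra [rho q / r] cancels the negative term of
   [A r^2], leaving [d + (n-1) rho q / r]. *)
rewrite -[X in _ + X = _]mulr_natl -[in LHS](prednK n1) -natr1 /A.
by field; rewrite expf_neq0 lt0r_neq0.
Qed.

End Residuals.

(** * The weighted density and the final equivalences *)

Lemma radial_mass_eq_weighted (R : realType) (n : nat) (q rho p : R -> R -> R) :
  quadrant_smooth rho ->
  (forall r t : R, 0 < r -> 0 < t -> rho r t = r ^- n.-1 * p r t) ->
  radial_mass_eq n q rho <-> weighted_mass_eq q p.
Proof.
move=> rho_smooth rhoE.
have pE (r t : R) : 0 < r -> 0 < t -> r ^+ n.-1 * rho r t = p r t.
  by move=> r0 t0; rewrite rhoE// mulrA divff ?mul1r// expf_neq0// lt0r_neq0.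
(* The two residuals differ by the nonzero factor [r^(n-1)], hence vanish together. *)
suff main (r t : R) : 0 < r -> 0 < t -> r ^+ n.-1 * (partial_t rho r t +
    r ^- n.-1 * partial_r (fun s t' => s ^+ n.-1 * rho s t' * q s t') r t) =
    partial_t p r t + partial_r (fun s t' => p s t' * q s t') r t.
  split=> H r t r0 t0; first by rewrite -main// H// mulr0.
  apply: (mulfI (expf_neq0 n.-1 (lt0r_neq0 r0))).
  by rewrite main// H// mulr0.
move=> r0 t0; rewrite mulrDr mulrA divff ?mul1r ?expf_neq0 ?lt0r_neq0//.
congr (_ + _).
  rewrite /partial_t !derive1E.
  have [Hd _] := quadrant_smooth_is_derive_t R rho r t rho_smooth r0 t0.
  (* The factor [r^(n-1)] is constant in time. Since [pE] holds only on the open quadrant,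
     derivatives are compared through equality near the point. *)
  rewrite -[LHS](deriveMl _ Hd); apply: near_eq_derive.
  by near=> s; rewrite -pE//; near: s; exact: lt_nbhsr.
rewrite /partial_r !derive1E; apply: near_eq_derive.
by near=> s; rewrite -pE//; near: s; exact: lt_nbhsr.
Unshelve. all: by end_near. Qed.

Theorem theorem2p2 (R : realType) (n : nat) (n_ge1 : (1 <= n)%N)
    (q rho : R -> R -> R)
    (q_smooth : quadrant_smooth q) (rho_smooth : quadrant_smooth rho) :
  (solves_system (@radial_velocity R n q) (@radial_density R n rho) <->
     radial_momentum_eq q /\ radial_mass_eq n q rho)
  /\
  (forall p : R -> R -> R,
     (forall r t : R, 0 < r -> 0 < t -> rho r t = r ^- n.-1 * p r t) ->
     (radial_mass_eq n q rho <-> weighted_mass_eq q p)).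
Proof.
split; last by move=> p; exact: radial_mass_eq_weighted.
split=> [H|[Hq Hrho] x t x0 t0]; last first.
  have r0 := eucl_norm_gt0 R n x x0; split.
  - exact: radial_has_first_partials.
  - by rewrite radial_momentum_residual// Hq// scale0r.
  - by rewrite radial_mass_residual// Hrho.
(* The radial equations are indexed by [r], the system by [x]: each [r] is realised on a coordinate
   axis, which exists because [1 <= n]. *)
have sphere (r : R) : 0 < r -> exists2 x : 'rV[R]_n, x != 0 & eucl_norm x = r.
  move=> r0; pose x : 'rV[R]_n := r *: delta_mx 0 (Ordinal n_ge1).
  have xr : eucl_norm x = r by exact: eucl_norm_scale_delta.
  exists x => //; rewrite scaler_eq0 negb_or lt0r_neq0//=.
  apply/eqP => /rowP/(_ (Ordinal n_ge1))/eqP.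
  by rewrite !mxE !eqxx oner_eq0.
split=> r t r0 t0; have [x x0 xr] := sphere r r0; have [_ Hm Hd] := H x t x0 t0.
  (* The vector residual is a scalar times the nonzero vector [x / r], so the scalar vanishes. *)
  move/eqP: Hm; rewrite radial_momentum_residual// xr 2!scaler_eq0.
  by rewrite invr_eq0 (negbTE x0) (negbTE (lt0r_neq0 r0)) !orbF => /eqP.
by move: Hd; rewrite radial_mass_residual// xr.
Qed.
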